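(* Let $X$ and $Y$ be nontrivial real Banach spaces. If $X$ and $Y$ have the symmetric strong diameter 2 property (SSD2P), then the projective tensor product $X\widehat{\otimes}_\pi Y$ has the SSD2P.
   Context: All Banach spaces are nontrivial (that is, nonzero) and over the real field. $B_X$ denotes the closed unit ball of a Banach space $X$, $S_X$ its unit sphere, and $X^*$ its dual. A slice of $B_X$ is a set of the form $S(B_X,x^*,\alpha)=\{x\in B_X : x^*(x)>1-\alpha\}$, where $x^*\in S_{X^*}$ and $\alpha>0$. A Banach space $X$ has the symmetric strong diameter 2 property (SSD2P) if, whenever $n\in\mathbb{N}$, $S_1,\dots,S_n$ are slices of $B_X$ and $\varepsilon>0$, there exist $x_i\in S_i$ ($i=1,\dots,n$) and $y\in B_X$, with $y$ independent of $i$, such that $x_i\pm y\in S_i$ for every $i\in\{1,\dots,n\}$ and $\|y\|>1-\varepsilon$. $X\widehat{\otimes}_\pi Y$ denotes the (completed) projective tensor product of $X$ and $Y$. *)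

(* Defs.v *)
From mathcomp Require Import all_boot all_order all_algebra.
From mathcomp Require Import all_classical all_reals all_analysis.
Set Implicit Arguments.
Unset Strict Implicit.
Unset Printing Implicit Defensive.
Import Order.TTheory GRing.Theory Num.Theory.
Import numFieldNormedType.Exports.
Local Open Scope classical_set_scope.
Local Open Scope ring_scope.

Definition unit_ball (R : realType) (X : normedModType R) : set X :=
  [set x | `|x| <= 1].
Arguments unit_ball {R} X.

(* [sup] is 0 on unbounded sets, so this is the dual norm only for
   continuous [f]. *)
Definition dual_norm (R : realType) (X : normedModType R) (f : {scalar X}) : R :=
  sup [set `|f x| | x in unit_ball X].

Definition dual_sphere (R : realType) (X : normedModType R) :
    set {scalar X} :=
  [set f : {scalar X} | continuous f /\ dual_norm f = 1].
Arguments dual_sphere {R} X.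

Definition slice (R : realType) (X : normedModType R)
    (f : {scalar X}) (a : R) : set X :=
  [set x | unit_ball X x /\ 1 - a < f x].

Definition is_slice (R : realType) (X : normedModType R) (S : set X) : Prop :=
  exists (f : {scalar X}) (a : R), [/\ dual_sphere X f, 0 < a & S = slice f a].

Definition SSD2P (R : realType) (X : normedModType R) : Prop :=
  forall (n : nat) (S : 'I_n -> set X) (e : R),
    (0 < n)%N -> (forall i, is_slice (S i)) -> 0 < e ->
    exists (x : 'I_n -> X) (y : X),
      [/\ unit_ball X y,
          forall i, [/\ S i (x i), S i (x i + y) & S i (x i - y)]
        & 1 - e < `|y|].

(* The element \sum_k x_k (x) y_k of Z represented by the finite list of the
   pairs (x_k, y_k), where [t x y] plays the role of x (x) y. No scalar
   coefficients are needed, as they can be absorbed in the x_k. *)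
Definition tensor_sum (R : realType) (X Y Z : lmodType R)
    (t : {bilinear X -> Y -> Z}) (s : seq (X * Y)) : Z :=
  \sum_(p <- s) t p.1 p.2.

Definition projective_norm (R : realType) (X Y : normedModType R)
    (Z : lmodType R) (t : {bilinear X -> Y -> Z}) (z : Z) : R :=
  inf [set \sum_(p <- s) `|p.1| * `|p.2| | s in [set s | tensor_sum t s = z]].

(* The Banach space Z, with the bilinear map t, is the completion of the
   algebraic tensor product of X and Y for the projective norm; these
   conditions determine (Z, t) up to a unique isometric isomorphism.
   - [ptp_alg]: a finite sum of elementary tensors is zero in the algebraic
     tensor product iff every bilinear form (continuous or not) vanishes on
     it. Hence this says that the linear map induced by t on the algebraic
     tensor product is injective, and identifies the latter with the range
     of [tensor_sum t].
   - [ptp_norm]: on that range, the norm of Z is the projective norm. *)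
Record is_projective_tensor_product (R : realType) (X Y : normedModType R)
    (Z : completeNormedModType R) (t : {bilinear X -> Y -> Z}) : Prop := {
  ptp_alg : forall s : seq (X * Y), tensor_sum t s = 0 ->
    forall B : {bilinear X -> Y -> R | *%R & *%R},
      \sum_(p <- s) B p.1 p.2 = 0;
  ptp_norm : forall z, range (tensor_sum t) z -> `|z| = projective_norm t z;
  ptp_dense : dense (range (tensor_sum t)) }.

(* Main.v *)
(** Elementary tensors of the unit balls are norming for the dual of the
tensor product, so each slice, given by a functional [f_i], contains some
[u_i ⊗ v_i]. The SSD2P of X, applied to the slices
[a |-> f_i (a ⊗ v_i)], yields [x_i] and a common [y]; the SSD2P of Y, applied to
the 2n slices [b |-> f_i ((x_i ± y) ⊗ b)], yields [v_i^±] and a common [w]. Put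
[z_i = ((x_i + y) ⊗ v_i^+ + (x_i - y) ⊗ v_i^-) / 2]. As
[y ⊗ w = ((x_i + y) ⊗ w - (x_i - y) ⊗ w) / 2], both
[z_i ± y ⊗ w = ((x_i + y) ⊗ (v_i^+ ± w) + (x_i - y) ⊗ (v_i^- ∓ w)) / 2]
are midpoints of two points of the slice.

Finally [‖y ⊗ w‖ = ‖y‖ ‖w‖] needs norming functionals. These are obtained as
minimal sublinear functionals: minimality forces linearity. *)
From HB Require Import structures.
Require Import Defs.
From mathcomp Require Import all_boot all_order all_algebra.
From mathcomp Require Import all_classical all_reals all_analysis.
From mathcomp Require Import lra.
Import Order.TTheory GRing.Theory Num.Theory.
Import numFieldNormedType.Exports.
Local Open Scope classical_set_scope.
Local Open Scope ring_scope.

(** * Sublinear functionals, minimality and norming functionals *)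

(** Homogeneity is asked only as an inequality, which passes directly to infima; for [0 < c]
    equality follows by scaling back with [c^-1]. *)
Definition sublinear {R : realType} {V : lmodType R} (p : V -> R) : Prop :=
  (forall a b, p (a + b) <= p a + p b) /\
  (forall c a, 0 <= c -> p (c *: a) <= c * p a).

Definition pack_scalar {R : realType} {V : lmodType R} {f : V -> R}
    (lf : linear_for *%R f) : {scalar V} :=
  HB.pack f (GRing.isLinear.Build R V R *%R f lf).

Lemma sublinear0 {R : realType} {V : lmodType R} (p : V -> R) :
  sublinear p -> p 0 = 0.
Proof.
move=> [pD pZ]; have := pD 0 0; have := pZ 0 0 (lexx 0).
rewrite scale0r addr0 mul0r; lra.
Qed.

Lemma sublinearZ {R : realType} {V : lmodType R} (p : V -> R) (c : R) (a : V) :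
  sublinear p -> 0 <= c -> p (c *: a) = c * p a.
Proof.
move=> sp; rewrite le_eqVlt => /predU1P[<-|c0].
  by rewrite scale0r mul0r sublinear0.
have [_ pZ] := sp; apply/eqP; rewrite eq_le (pZ _ _ (ltW c0))/=.
rewrite -ler_pdivlMl//.
by have := pZ c^-1 (c *: a); rewrite scalerK ?gt_eqF// invr_ge0 ltW// => ->.
Qed.

Lemma sublinear_opp_le {R : realType} {V : lmodType R} (p : V -> R) (a : V) :
  sublinear p -> - p (- a) <= p a.
Proof.
by move=> sp; have := sp.1 a (- a); rewrite subrr sublinear0//; lra.
Qed.

(** Since [inf] is 0 on sets not bounded below, the minorant [b] is what makes the infimum genuine.
    The member [h] may depend on the points, so chains and the family defining [steepen] are both
    covered. *)
Lemma sublinear_inf {R : realType} {V : lmodType R} (F : set (V -> R))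
    (b : V -> R) :
  F !=set0 -> (forall f, F f -> forall a, b a <= f a) ->
  (forall f g, F f -> F g -> forall a a',
    exists2 h, F h & h (a + a') <= f a + g a') ->
  (forall f, F f -> forall c a, 0 <= c ->
    exists2 h, F h & h (c *: a) <= c * f a) ->
  sublinear (fun a => inf [set f a | f in F]).
Proof.
move=> [f0 Ff0] Fb FD FZ.
have nonempty a : [set f a | f in F] !=set0 by exists (f0 a), f0.
have inf_le f a : F f -> inf [set f a | f in F] <= f a.
  move=> Ff; apply: ge_inf; last by exists f.
  by exists (b a) => _ [g Fg <-]; apply: Fb.
split=> [a a'|c a c0].
  rewrite -lerBlDr; apply: lb_le_inf => // _ [f Ff <-].
  rewrite lerBlDr -lerBlDl; apply: lb_le_inf => // _ [g Fg <-].
  rewrite lerBlDl; have [h Fh] := FD f g Ff Fg a a'.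
  exact: le_trans (inf_le _ _ Fh).
have H f : F f -> inf [set f (c *: a) | f in F] <= c * f a.
  by move=> Ff; have [h Fh] := FZ f Ff c a c0; apply: le_trans (inf_le _ _ Fh).
move: c0 H; rewrite le_eqVlt => /predU1P[<-|c0] H.
  by have := H _ Ff0; rewrite !mul0r.
rewrite -ler_pdivrMl//; apply: lb_le_inf => // _ [f Ff <-].
by rewrite ler_pdivrMl// H.
Qed.

(* [steepen p y] is sublinear, lies below [p] and takes a value at most
   [- p y] at [- y]. *)
Definition steepen {R : realType} {V : lmodType R} (p : V -> R) (y a : V) : R :=
  inf [set f a | f in [set f | exists2 t, 0 <= t &
    f = fun a => p (a + t *: y) - t * p y]].

Lemma steepen_ge {R : realType} {V : lmodType R} (p : V -> R) (y a : V) (t : R) :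
  sublinear p -> 0 <= t -> - p (- a) <= p (a + t *: y) - t * p y.
Proof.
move=> sp t0; have := sp.1 (a + t *: y) (- a).
by rewrite addrAC subrr add0r sublinearZ//; lra.
Qed.

Lemma steepen_le {R : realType} {V : lmodType R} (p : V -> R) (y a : V) (t : R) :
  sublinear p -> 0 <= t -> steepen p y a <= p (a + t *: y) - t * p y.
Proof.
move=> sp t0; apply: ge_inf; last first.
  by exists (fun a => p (a + t *: y) - t * p y) => //; exists t.
by exists (- p (- a)) => _ [_ [u u0 ->] <-]; apply: steepen_ge.
Qed.

(** The parameters [t] and [u] add up under sums of points, and [t] becomes [c * t] under
    scaling. *)
Lemma sublinear_steepen {R : realType} {V : lmodType R} (p : V -> R) (y : V) :
  sublinear p -> sublinear (steepen p y).
Proof.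
move=> sp; apply: (@sublinear_inf _ _ _ (fun a => - p (- a))).
- by exists (fun a => p (a + 0 *: y) - 0 * p y), 0.
- by move=> _ [t t0 ->] a; apply: steepen_ge.
- move=> _ _ [t t0 ->] [u u0 ->] a a'.
  exists (fun a => p (a + (t + u) *: y) - (t + u) * p y).
    by exists (t + u); rewrite ?addr_ge0.
  by rewrite scalerDl addrACA; have := sp.1 (a + t *: y) (a' + u *: y); lra.
- move=> _ [t t0 ->] c a c0.
  exists (fun a => p (a + (c * t) *: y) - (c * t) * p y).
    by exists (c * t); rewrite ?mulr_ge0.
  by rewrite -scalerA -scalerDr sublinearZ// mulrBr mulrA.
Qed.

Lemma steepen_le_id {R : realType} {V : lmodType R} (p : V -> R) (y a : V) :
  sublinear p -> steepen p y a <= p a.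
Proof.
by move=> sp; have := steepen_le p y a 0 sp (lexx 0);
  rewrite scale0r addr0 mul0r subr0.
Qed.

Lemma steepen_opp {R : realType} {V : lmodType R} (p : V -> R) (y : V) :
  sublinear p -> steepen p y (- y) <= - p y.
Proof.
move=> sp; have := steepen_le p y (- y) 1 sp ler01.
by rewrite scale1r addNr sublinear0// mul1r sub0r.
Qed.

(** By minimality [steepen p a] equals [p], so [steepen_opp] gives [p (- a) <= - p a]. Hence [p] is
    odd, and subadditivity at opposite points becomes superadditivity. *)
Lemma minimal_sublinear_linear {R : realType} {V : lmodType R} (p : V -> R) :
  sublinear p ->
  (forall q, sublinear q -> (forall a, q a <= p a) -> q = p) ->
  linear_for *%R p.
Proof.
move=> sp pmin.
have pN a : p (- a) = - p a.
  apply/eqP; rewrite eq_le -[X in _ && X]lerN2 opprK.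
  have := sublinear_opp_le p a sp; rewrite lerNl => ->; rewrite andbT.
  have := steepen_opp p a sp.
  rewrite (pmin _ (sublinear_steepen p a sp))// => b.
  exact: steepen_le_id.
have pD a b : p (a + b) = p a + p b.
  apply/eqP; rewrite eq_le sp.1/=.
  by have := sp.1 (- a) (- b); rewrite -opprD !pN; lra.
move=> c a b; rewrite pD; congr (_ + _).
have [c0|c0] := leP 0 c; first exact: sublinearZ.
by rewrite -[in LHS](opprK c) scaleNr pN sublinearZ ?oppr_ge0 1?ltW// mulNr opprK.
Qed.

(** Zorn's lemma for the reversed pointwise order: a nonempty chain is bounded by its pointwise
    infimum, which is finite because [- p (- a) <= - q (- a) <= q a] for each member [q]. *)
Lemma minimal_sublinear_exists {R : realType} {V : lmodType R} (p : V -> R) :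
  sublinear p -> exists q, [/\ sublinear q, forall a, q a <= p a &
    forall q', sublinear q' -> (forall a, q' a <= q a) -> q' = q].
Proof.
move=> sp.
pose T := {q : V -> R | sublinear q /\ forall a, q a <= p a}.
pose below (q r : T) : bool := `[< forall a, sval r a <= sval q a >].
have [||||[q [sq qp]] qmin] := @Zorn T below.
- by move=> q; apply/asboolP.
- move=> q r s /asboolP qr /asboolP rs; apply/asboolP => a.
  exact: le_trans (rs a) (qr a).
- move=> [q sq] [r sr] /asboolP/= rq /asboolP/= qr; apply: eq_exist => /=.
  by apply/funext => a; apply/eqP; rewrite eq_le rq qr.
(* Over the empty chain the infimum would be the default value 0, which need not lie below [p];
   there [p] itself serves. *)
- move=> A Atot; have [->|/set0P[q0 Aq0]] := eqVneq A set0.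
    by exists (exist _ p (conj sp (fun a => lexx _)) : T).
  pose F := [set sval q | q in A].
  have Fb f : F f -> forall a, - p (- a) <= f a.
    move=> [[q [sq qp]] _ <-] a /=.
    by rewrite (le_trans _ (sublinear_opp_le q a sq))// lerN2.
  have Ff0 : F (sval q0) by exists q0.
  have sF : sublinear (fun a => inf [set f a | f in F]).
    apply: (@sublinear_inf _ _ _ (fun a => - p (- a))) => //.
    - by exists (sval q0).
    - move=> _ _ [q Aq <-] [r Ar <-] a a'.
      have [/asboolP rq|/asboolP qr] := Atot q r Aq Ar.
        exists (sval r); first by exists r.
        by rewrite (le_trans ((svalP r).1.1 a a'))// lerD2r.
      exists (sval q); first by exists q.
      by rewrite (le_trans ((svalP q).1.1 a a'))// lerD2l.
    - move=> _ [q Aq <-] c a c0; exists (sval q); first by exists q.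
      exact: (svalP q).1.2.
  have Finf f a : F f -> inf [set f a | f in F] <= f a.
    move=> Ff; apply: ge_inf; last by exists f.
    by exists (- p (- a)) => _ [g Fg <-]; apply: Fb.
  have Fp a : inf [set f a | f in F] <= p a.
    exact: le_trans (Finf _ a Ff0) ((svalP q0).2 a).
  exists (exist _ (fun a => inf [set f a | f in F]) (conj sF Fp) : T) => q Aq; apply/asboolP => a /=.
  by apply: Finf; exists q.
- exists q; split=> // r sr rq.
  have rp a : r a <= p a by apply: le_trans (qp a).
  have := qmin (exist _ r (conj sr rp) : T).
  by move=> /(_ (introT (asboolP _) rq)) [].
Qed.


Lemma norming_functional {R : realType} {V : normedModType R} (x : V) :
  exists f : {scalar V}, f x = `|x| /\ forall a, `|f a| <= `|a|.
Proof.
pose p (a : V) : R := `|a|.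
have sp : sublinear p.
  split=> [a b|c a c0]; first exact: ler_normD.
  by rewrite /p normrZ ger0_norm.
(* Minimising below [steepen p x] rather than [p] forces [q (- x) <= - p x], that is [p x <= q x]
   once [q] is linear. *)
have [q [sq qp qmin]] :=
  minimal_sublinear_exists _ (sublinear_steepen p x sp).
have q_le a : q a <= `|a|.
  exact: le_trans (qp a) (steepen_le_id p x a sp).
pose f := pack_scalar (minimal_sublinear_linear _ sq qmin).
have fN a : q (- a) = - q a by rewrite -[q]/(f : V -> R) linearN.
exists f; split=> [|a] /=.
  apply/eqP; rewrite eq_le q_le/= -lerN2 -fN.
  exact: le_trans (qp (- x)) (steepen_opp p x sp).
by rewrite ler_norml q_le andbT lerNl -fN -[leRHS]normrN q_le.
Qed.

(** * Continuous functionals, the dual norm and slices *)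

Lemma scalar_bounded_continuous {R : realType} {V : normedModType R}
    (f : {scalar V}) (M : R) :
  (forall a, `|f a| <= M * `|a|) -> continuous f.
Proof.
move=> fM; pose g : {linear V -> R^o} := HB.pack (f : V -> R^o)
  (GRing.isLinear.Build R V R^o *:%R f (linearP f)).
have : continuous g.
  apply/linear_bounded_continuous/linear_boundedP.
  near=> r => a; apply: le_trans (fM a) _.
  by rewrite ler_wpM2r//; near: r; apply: nbhs_pinfty_ge; rewrite num_real.
by [].
Unshelve. all: by end_near. Qed.

Lemma continuous_scalar_bounded {R : realType} {V : normedModType R}
    (f : {scalar V}) :
  continuous f -> exists M, forall a, `|f a| <= M * `|a|.
Proof.
move=> cf; pose g : {linear V -> R^o} := HB.pack (f : V -> R^o)
  (GRing.isLinear.Build R V R^o *:%R f (linearP f)).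
have /linear_bounded_continuous/linear_boundedP gM : continuous g := cf.
by have [M gM'] := filter_ex gM; exists M.
Qed.

(** The bound [M] makes the supremum in [dual_norm] genuine. *)
Lemma dual_norm_ge {R : realType} {V : normedModType R} (f : {scalar V})
    (M : R) (a : V) :
  (forall a, `|f a| <= M * `|a|) -> `|a| <= 1 -> `|f a| <= dual_norm f.
Proof.
move=> fM a1; apply: ub_le_sup; last by exists a.
exists `|M| => _ [b b1 <-]; apply: (le_trans (fM b)).
apply: (@le_trans _ _ (`|M| * `|b|)); first by rewrite ler_wpM2r// ler_norm.
by rewrite ler_piMr.
Qed.

Lemma dual_norm_le {R : realType} {V : normedModType R} (f : {scalar V})
    (M : R) :
  (forall a, `|a| <= 1 -> `|f a| <= M) -> dual_norm f <= M.
Proof.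
move=> fM; apply: ge_sup => [|_ [a a1 <-]]; last exact: fM.
by exists `|f 0|, 0; rewrite //= /unit_ball/= normr0.
Qed.

(** Dividing [f] by its dual norm [c] puts it on the dual sphere and turns the threshold [m] into
    [m / c]. The point [u] ensures [m < c], so the width [1 - m / c] is positive. *)
Lemma is_slice_threshold {R : realType} {V : normedModType R} (f : {scalar V})
    (m : R) (u : V) :
  continuous f -> 0 <= m -> unit_ball V u -> m < f u ->
  is_slice [set a | unit_ball V a /\ m < f a].
Proof.
move=> cf m0 u1 mu; have [M fM] := continuous_scalar_bounded _ cf.
set c := dual_norm f.
have uc : f u <= c := le_trans (ler_norm _) (dual_norm_ge f M u fM u1).
have mc : m < c := lt_le_trans mu uc.
have c0 : 0 < c := le_lt_trans m0 mc.
have lg : linear_for *%R (fun a => c^-1 * f a).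
  by move=> k a b; rewrite linearP mulrDr mulrCA.
pose g := pack_scalar lg.
have gM a : `|g a| <= c^-1 * M * `|a|.
  by rewrite /= normrM gtr0_norm ?invr_gt0// -mulrA ler_pM2l ?invr_gt0.
exists g, (1 - m / c); split.
- split; first exact: scalar_bounded_continuous gM.
  apply/eqP; rewrite eq_le; apply/andP; split.
    apply: dual_norm_le => a a1 /=.
    rewrite normrM gtr0_norm ?invr_gt0// ler_pdivrMl// mulr1.
    exact: (dual_norm_ge f M).
  rewrite -(ler_pM2l c0) mulr1; apply: dual_norm_le => a a1.
  rewrite -ler_pdivrMl//.
  have := dual_norm_ge g _ a gM a1.
  by rewrite /= normrM gtr0_norm ?invr_gt0.
- by rewrite subr_gt0 ltr_pdivrMr// mul1r.
- apply/seteqP; split=> a [a1 ma]; split=> //=; move: ma => /=.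
    by rewrite opprB addrC subrK mulrC ltr_pM2l ?invr_gt0.
  by rewrite opprB addrC subrK mulrC ltr_pM2l ?invr_gt0.
Qed.

(** Allows families indexed by ['I_n * bool], as the signed slices of Y are. *)
Lemma SSD2P_finType {R : realType} {V : normedModType R} (I : finType)
    (S : I -> set V) (e : R) :
  SSD2P V -> (0 < #|I|)%N -> (forall i, is_slice (S i)) -> 0 < e ->
  exists (x : I -> V) (y : V),
    [/\ unit_ball V y,
        forall i, [/\ S i (x i), S i (x i + y) & S i (x i - y)]
      & 1 - e < `|y|].
Proof.
move=> sV I0 sS e0.
have [x [y [y1 xy ye]]] := sV _ (fun k => S (enum_val k)) e I0
  (fun k => sS (enum_val k)) e0.
exists (x \o enum_rank), y; split=> // i.
by have := xy (enum_rank i); rewrite enum_rankK.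
Qed.

(** * Elementary tensors and the projective norm *)

Definition pack_bilinear {R : realType} {U V : lmodType R} {B : U -> V -> R}
    (lB : bilinear_for *%R *%R B) : {bilinear U -> V -> R | *%R & *%R} :=
  HB.pack B (bilinear_isBilinear.Build R U V R *%R *%R B lB).

Section ProjectiveTensorProduct.
Context {R : realType} {X Y : normedModType R} {Z : completeNormedModType R}
  {t : {bilinear X -> Y -> Z}} (Zt : is_projective_tensor_product t).

Lemma tensor_norm_le_sum (s : seq (X * Y)) :
  `|tensor_sum t s| <= \sum_(p <- s) `|p.1| * `|p.2|.
Proof.
rewrite (ptp_norm Zt); last by exists s.
apply: ge_inf; last by exists s.
by exists 0 => _ [s' _ <-]; apply: sumr_ge0 => p _; rewrite mulr_ge0.
Qed.

(** The one-term representation bounds the norm from above. For the lower bound, the product of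
    norming functionals of [x] and [y] is a bilinear form, which by [ptp_alg] takes the same value
    on every representation of [t x y]. *)
Lemma tensor_norm (x : X) (y : Y) : `|t x y| = `|x| * `|y|.
Proof.
have txy : t x y = tensor_sum t [:: (x, y)] by rewrite /tensor_sum big_seq1.
apply/eqP; rewrite eq_le; apply/andP; split.
  by have := tensor_norm_le_sum [:: (x, y)]; rewrite -txy big_seq1.
have [f [fx fle]] := norming_functional x.
have [g [gy gle]] := norming_functional y.
have lB : bilinear_for *%R *%R (fun a b => f a * g b).
  split=> [b k a a'|a k b b'].
    by rewrite /= linearP /= mulrDl mulrA.
  by rewrite /= linearP /= mulrDr mulrCA.
rewrite (ptp_norm Zt); last by exists [:: (x, y)].
apply: lb_le_inf; first by exists (\sum_(p <- [:: (x, y)]) `|p.1| * `|p.2|),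
  [:: (x, y)].
move=> _ [s /= st <-].
have st0 : tensor_sum t ((- x, y) :: s) = 0.
  by rewrite /tensor_sum big_cons /= linearNl -/(tensor_sum t s) st addNr.
have := ptp_alg Zt st0 (pack_bilinear lB).
rewrite big_cons /= linearN fx gy mulNr addrC.
move=> /eqP; rewrite subr_eq0 => /eqP <-.
apply: ler_sum => p _; apply: le_trans (ler_norm _) _.
by rewrite normrM ler_pM.
Qed.

(** Otherwise, by rescaling and summing, [f] is at most [M < 1] times the projective norm on finite
    sums, hence everywhere by density, against [dual_norm f = 1]. *)
Lemma elementary_tensor_gt (f : {scalar Z}) (m : R) :
  dual_sphere Z f -> 0 <= m < 1 ->
  exists u v, [/\ unit_ball X u, unit_ball Y v & m < f (t u v)].
Proof.
move=> [cf f1] /andP[m0 m1]; apply: contrapT => /forallNP no.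
(* [m] may be 0, while the comparison with the infimum divides by the bound. *)
have [M [M0 M1 mM]] : exists M : R, [/\ 0 < M, M < 1 & m <= M].
  by exists ((m + 1) / 2); split; lra.
have fle u v : `|u| <= 1 -> `|v| <= 1 -> f (t u v) <= M.
  move=> u1 v1; rewrite (le_trans _ mM)// leNgt; apply/negP => mf.
  by apply: (no u); exists v.
have fabs u v : `|f (t u v)| <= M * (`|u| * `|v|).
  have [->|u0] := eqVneq u 0.
    by rewrite linear0l linear0 !normr0 mul0r mulr0.
  have [->|v0] := eqVneq v 0.
    by rewrite linear0r linear0 !normr0 !mulr0.
  have fle' w : `|w| = `|u| -> f (t w v) <= M * (`|u| * `|v|).
    move=> wu; have := fle (`|u|^-1 *: w) (`|v|^-1 *: v).
    rewrite !normrZ !normfV !normr_id wu !mulVf ?normr_eq0// => /(_ (lexx _) (lexx _)).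
    rewrite linearZl linearZr !linearZ/= ler_pdivrMl ?normr_gt0//.
    by rewrite ler_pdivrMl ?normr_gt0// mulrA mulrC (mulrC `|v|).
  (* The lower bound is the upper bound at [- u]. *)
  rewrite ler_norml fle'// andbT lerNl -linearN -linearNl fle'//.
  exact: normrN.
have fsum s : `|f (tensor_sum t s)| <= M * `|tensor_sum t s|.
  rewrite (ptp_norm Zt); last by exists s.
  rewrite -ler_pdivrMl//; apply: lb_le_inf.
    by exists (\sum_(p <- s) `|p.1| * `|p.2|), s.
  move=> _ [s' /= <- <-]; rewrite ler_pdivrMl// linear_sum mulr_sumr.
  by apply: (le_trans (ler_norm_sum _ _ _)); apply: ler_sum => p _.
have fall z : `|f z| <= M * `|z|.
  (* Violating the bound is an open condition, so it would also occur at a finite sum. *)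
  rewrite leNgt; apply/negP => fz.
  pose h z := `|f z| - M * `|z|.
  have ch : continuous h.
    move=> w; apply: cvgB; first exact: (cvg_norm (cf w)).
    by apply: cvgMr; exact: (cvg_norm cvg_id).
  have oh : open (h @^-1` [set r | 0 < r]).
    by apply: open_comp => [w _|]; [exact: ch|exact: open_gt].
  have [|w [hw [s _ sw]]] := ptp_dense Zt _ oh.
    by exists z; rewrite /h /= subr_gt0.
  by move: hw; rewrite /h /= subr_gt0 ltNge -sw fsum.
have : dual_norm f <= M.
  apply: dual_norm_le => z z1; apply: (le_trans (fall z)).
  by rewrite ler_piMr// ltW.
by rewrite f1 leNgt M1.
Qed.
End ProjectiveTensorProduct.

(** * Symmetric slices of the projective tensor product *)

Theorem theorem2p2 (R : realType) (X Y : completeNormedModType R)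
    (hX : exists x : X, x != 0) (hY : exists y : Y, y != 0)
    (XY : completeNormedModType R) (t : {bilinear X -> Y -> XY})
    (hXY : is_projective_tensor_product t) :
  SSD2P X -> SSD2P Y -> SSD2P XY.
Proof.
move=> sX sY n S e n0 sS e0.
have /choice[fa fS] : forall i, exists fa : {scalar XY} * R,
    [/\ dual_sphere XY fa.1, 0 < fa.2 & S i = slice fa.1 fa.2].
  by move=> i; have [f [a fa]] := sS i; exists (f, a).
pose f i := (fa i).1.
(* A slice of width above 1 has a negative threshold; clipping at 0 shrinks the slice and gives the
   nonnegative threshold that [is_slice_threshold] takes. *)
pose m i := Num.max 0 (1 - (fa i).2).
have m0 i : 0 <= m i by rewrite le_max lexx.
have m1 i : m i < 1.
  by rewrite gt_max ltr01/=; have [_ ? _] := fS i; lra.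
have S_gt i z : `|z| <= 1 -> m i < f i z -> S i z.
  move=> z1 mz; have [_ _ ->] := fS i; split=> //.
  by apply: le_lt_trans mz; rewrite le_max lexx orbT.
have fcont i : continuous (f i) by have [[]] := fS i.
have /choice[uv uv_gt] : forall i, exists uv : X * Y,
    [/\ `|uv.1| <= 1, `|uv.2| <= 1 & m i < f i (t uv.1 uv.2)].
  move=> i; have [fi _ _] := fS i.
  have mi : 0 <= m i < 1 by rewrite m0 m1.
  by have [u [v ?]] := elementary_tensor_gt hXY (f i) (m i) fi mi; exists (u, v).
have slX i (v : Y) (u : X) : `|u| <= 1 -> m i < f i (t u v) ->
    is_slice [set a | unit_ball X a /\ m i < f i (t a v)].
  move=> u1 mu.
  have lg : linear_for *%R (fun a => f i (t a v)).
    by move=> k a b; rewrite linearPl linearP.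
  have [M fM] := continuous_scalar_bounded _ (fcont i).
  apply: (is_slice_threshold (pack_scalar lg) _ u) => //.
  apply: (scalar_bounded_continuous _ (M * `|v|)) => a.
  by rewrite (le_trans (fM _))// (tensor_norm hXY) mulrAC mulrA.
have slY i (u : X) (v : Y) : `|v| <= 1 -> m i < f i (t u v) ->
    is_slice [set b | unit_ball Y b /\ m i < f i (t u b)].
  move=> v1 mv.
  have lg : linear_for *%R (fun b => f i (t u b)).
    by move=> k a b; rewrite linearPr linearP.
  have [M fM] := continuous_scalar_bounded _ (fcont i).
  apply: (is_slice_threshold (pack_scalar lg) _ v) => //.
  apply: (scalar_bounded_continuous _ (M * `|u|)) => a.
  by rewrite (le_trans (fM _))// (tensor_norm hXY) mulrA.
(* As [d <= 1], the lower bounds [1 - d] for the norms of [y] and [w] multiply to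
   [(1 - d) ^+ 2 >= 1 - 2 * d >= 1 - e]. *)
pose d := Num.min (e / 2) 1.
have d0 : 0 < d by rewrite lt_min ltr01 divr_gt0.
have [x [y [y1 xy yd]]] := sX n
  (fun i => [set a | unit_ball X a /\ m i < f i (t a (uv i).2)]) d n0
  (fun i => let: And3 u1 _ mu := uv_gt i in slX i _ _ u1 mu) d0.
(* The boolean is the sign of [y]. *)
pose xs (k : 'I_n * bool) := x k.1 + (if k.2 then y else - y).
have xs1 k : `|xs k| <= 1.
  by case: k => i [] /=; have [_ [? _] [? _]] := xy i.
have xs_gt k : m k.1 < f k.1 (t (xs k) (uv k.1).2).
  by case: k => i [] /=; have [_ [_ ?] [_ ?]] := xy i.
have In0 : (0 < #|{: 'I_n * bool}|)%N.
  by rewrite card_prod card_ord card_bool muln_gt0 n0.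
(* Both signs are treated in one application so that [w] is common to them; [(uv k.1).2] shows that
   each slice is nonempty. *)
have [v [w [w1 vw wd]]] := SSD2P_finType _
  (fun k => [set b | unit_ball Y b /\ m k.1 < f k.1 (t (xs k) b)]) d sY In0
  (fun k => let: And3 _ v1 _ := uv_gt k.1 in slY k.1 _ _ v1 (xs_gt k)) d0.
pose z i := 2^-1 *: (t (xs (i, true)) (v (i, true)) +
                     t (xs (i, false)) (v (i, false))).
have avg i a b a' b' : `|a| <= 1 -> `|b| <= 1 -> `|a'| <= 1 -> `|b'| <= 1 ->
    m i < f i (t a b) -> m i < f i (t a' b') ->
    S i (2^-1 *: (t a b + t a' b')).
  move=> a1 b1 a'1 b'1 ab ab'; apply: S_gt.
    have := mulr_ile1 (normr_ge0 a) (normr_ge0 b) a1 b1.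
    have := mulr_ile1 (normr_ge0 a') (normr_ge0 b') a'1 b'1.
    rewrite -!(tensor_norm hXY) normrZ ger0_norm ?invr_ge0//.
    by have := ler_normD (t a b) (t a' b'); lra.
  by rewrite linearZ linearD /=; lra.
exists z, (t y w); split.
- by rewrite /unit_ball /= (tensor_norm hXY) mulr_ile1.
- move=> i.
  have [[vT1 vT] [vTp1 vTp] [vTm1 vTm]] := vw (i, true).
  have [[vF1 vF] [vFp1 vFp] [vFm1 vFm]] := vw (i, false).
  have sum_xs : xs (i, true) - xs (i, false) = 2%:R *: y.
    by rewrite /xs /= opprD opprK addrACA subrr add0r scaler_nat mulr2n.
  have half : t y w = 2^-1 *: (t (xs (i, true)) w - t (xs (i, false)) w).
    by rewrite -linearBl sum_xs linearZl_LR scalerA mulVf ?scale1r// pnatr_eq0.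
  split; first exact: avg.
  (* As [y] is half the difference of the two left factors, [w] is added to one right factor and
     subtracted from the other; [vw] keeps both in their slices. *)
  + rewrite half -scalerDr addrACA -linearNr -!linearDr.
    exact: avg.
  + rewrite half -scalerBr opprD opprK addrACA -linearNr -!linearDr.
    exact: avg.
- rewrite (tensor_norm hXY).
  have : d <= e / 2 by rewrite ge_min lexx.
  have : d <= 1 by rewrite ge_min lexx orbT.
  nra.
Qed.
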